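(* For every integer $i$ with $1\le i\le 8$, the smallest good $i$-abundant number equals the smallest $i$-layered number; that is, writing $g_i$ for the smallest good $i$-abundant number and $k_i$ for the smallest $i$-layered number, $g_i=k_i$ for $1\le i\le 8$.
   Context: $\sigma(n)$ denotes the sum of the positive divisors of $n$, and $I(n)=\sigma(n)/n$. For a positive integer $k$, a positive integer $n$ is called $k$-layered if the set of all positive divisors of $n$ can be partitioned into $k$ subsets having the same sum of elements. A positive integer $n$ is called good $k$-abundant if $I(n)\ge k$ and $k\mid\sigma(n)$. *)

(* Defs.v *)
From mathcomp Require Import all_boot all_order all_algebra.

Set Implicit Arguments.
Unset Strict Implicit.
Unset Printing Implicit Defensive.

Import Order.TTheory GRing.Theory Num.Theory.

Definition sigma (n : nat) : nat := \sum_(d <- divisors n) d.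

Definition abundancy (n : nat) : rat := ((sigma n)%:R / n%:R)%R.

(* The divisors of n > 0 all lie in 'I_n.+1, which serves as the ambient finite
   type; for n > 0 the element 0 of 'I_n.+1 is not a divisor of n. *)
Definition divisor_set (n : nat) : {set 'I_n.+1} := [set d : 'I_n.+1 | d %| n].

(* MathComp's [partition] requires nonempty blocks. For k > 0 this is no
   restriction: an empty block would force the common sum to be 0. *)
Definition layered (k n : nat) : Prop :=
  0 < n /\
  exists P : {set {set 'I_n.+1}},
    [/\ partition P (divisor_set n), #|P| = k &
        {in P &, forall A B : {set 'I_n.+1},
           \sum_(d in A) (d : nat) = \sum_(d in B) (d : nat)}].

Definition good_abundant (k n : nat) : Prop :=
  [/\ 0 < n, (k%:R <= abundancy n)%R & k %| sigma n].

Definition smallest (P : nat -> Prop) (n : nat) : Prop :=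
  P n /\ forall m : nat, P m -> n <= m.

(* Main.v *)
From Stdlib Require Import NArith.
Require Import Defs.
From mathcomp Require Import all_boot all_order all_algebra.
From mathcomp Require Import zify ring lra.

(** The sum of the blocks of a k-layered number n is sigma(n), and the block of
    n has sum at least n, so k-layered numbers are good k-abundant. It remains
    to see, for the number g of each of the eight cases, that no m < g is good
    k-abundant and that g is k-layered.

    Minimality. With eps a suitable constant, the multiplicative function
    I(m) / m^eps is bounded by the product of its maxima over the powers of each
    prime, as for colossally abundant numbers. Since m^eps < g^eps, the
    inequality I(m) >= k leaves very few possibilities for the exponents of m,
    and these are enumerated, prime after prime, in fixed-point arithmetic.

    Layering. For k <= 4 a partition is given. For k >= 5, put the divisors of
    g greater than some D0, in decreasing order, each into the bin of largest
    remaining capacity. The total remaining capacity is the sum S(d) of the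
    divisors <= d, so if S(d) >= k (d + mu) then all capacities stay >= mu.
    This inequality passes from n to a multiple of n, which reduces it to
    the divisors of a small factor of g. Finally the divisors <= D0, cut into k
    blocks with many subset sums, complete the bins one after the other. *)

Set Implicit Arguments.
Unset Strict Implicit.
Unset Printing Implicit Defensive.

Import Order.TTheory GRing.Theory Num.Theory.

(** * Layered and good abundant numbers *)

Lemma sum_divisors_subset n (n_gt0 : 0 < n) (p : pred nat) :
  \sum_(d in [set d in divisor_set n | p (d : nat)]) (d : nat) =
  \sum_(d <- divisors n | p d) d.
Proof.
rewrite (eq_bigl (fun d : 'I_n.+1 => (d %| n) && p d)); last first.
  by move=> d; rewrite !inE.
rewrite -(big_mkord (fun d => (d %| n) && p d) id) -big_filter.
rewrite -[RHS]big_filter; apply: perm_big; apply: uniq_perm.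
- by rewrite filter_uniq ?iota_uniq.
- by rewrite filter_uniq ?divisors_uniq.
move=> d; rewrite !mem_filter mem_index_iota -dvdn_divisors //=.
case: (p d); rewrite ?andbF //= !andbT.
by case: (boolP (d %| n)) => //= /(dvdn_leq n_gt0); rewrite ltnS.
Qed.

Lemma sigma_sumn n : sigma n = sumn (divisors n).
Proof. by rewrite /sigma sumnE. Qed.

Lemma leq_sigma n : 0 < n -> n <= sigma n.
Proof.
move=> n_gt0; rewrite /sigma (big_rem n) /=; first exact: leq_addr.
exact: divisors_id.
Qed.

Lemma good_abundantE k n :
  good_abundant k n <-> [/\ 0 < n, k * n <= sigma n & k %| sigma n].
Proof.
suff abE : 0 < n -> (k%:R <= abundancy n)%R = (k * n <= sigma n).
  by split=> -[n0 h1 h2]; split; rewrite // ?abE // -?abE.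
by move=> n0; rewrite /abundancy ler_pdivlMr ?ltr0n // -natrM ler_nat.
Qed.

Lemma layered_good k n : layered k n -> good_abundant k n.
Proof.
move=> [n_gt0 [P [partP <- eqP]]]; apply/good_abundantE.
have sigE : sigma n = \sum_(A in P) \sum_(d in A) (d : nat).
  rewrite -(set_partition_big _ partP) /=.
  rewrite /sigma -(sum_divisors_subset n_gt0 xpredT).
  by apply: eq_bigl => d; rewrite !inE andbT.
have n_in : ord_max \in cover P by rewrite (cover_partition partP) inE.
case/bigcupP: n_in => A AP nA.
have {}sigE : sigma n = #|P| * \sum_(d in A) (d : nat).
  by rewrite sigE -sum_nat_const; apply: eq_bigr => B BP; apply: eqP.
split=> //; last by rewrite sigE dvdn_mulr.
rewrite sigE leq_mul2l; apply/orP; right.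
by rewrite (bigD1 ord_max) //= leq_addr.
Qed.

(** Layered numbers are good, so a layered number below which nothing is good is the minimum of both
    kinds. *)
Lemma smallest_good_layered k n : layered k n ->
  (forall m, m < n -> ~ good_abundant k m) ->
  exists g l, [/\ smallest (good_abundant k) g, smallest (layered k) l & g = l].
Proof.
move=> lay min; exists n, n; split=> //; split.
- exact: layered_good.
- by move=> m gm; rewrite leqNgt; apply/negP => /min.
- by [].
- by move=> m /layered_good gm; rewrite leqNgt; apply/negP => /min.
Qed.

(** Partitions in list form. The capacities in [c] may differ from bin to bin, which allows filling
    the bins one item at a time. *)
Definition realizable (l c : seq nat) :=
  exists2 bins, perm_eq (flatten bins) l & map sumn bins = c.

Lemma realizable_perm l l' c : perm_eq l l' -> realizable l c -> realizable l' c.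
Proof. by move=> ll' [b bl bc]; exists b => //; apply: perm_trans ll'. Qed.

Lemma realizable_layered k n T : 0 < n -> 0 < T ->
  realizable (divisors n) (nseq k T) -> layered k n.
Proof.
move=> n_gt0 T_gt0 [bins permb sumb]; split=> //.
have sizeb : size bins = k by rewrite -(size_map sumn) sumb size_nseq.
(* [f d] is the index of the bin containing [d], unique because [flatten bins] has no repetition;
   the blocks are the fibres of [f]. *)
pose f d := find (fun b : seq nat => d \in b) bins.
have uniqb : uniq (flatten bins) by rewrite (perm_uniq permb) divisors_uniq.
have fP d b1 b b2 : bins = b1 ++ b :: b2 -> d \in flatten bins ->
    (f d == size b1) = (d \in b).
  move=> bE; have := uniqb; rewrite /f bE flatten_cat cat_uniq /= cat_uniq.
  case/and3P=> _ /hasPn/= dis _ d_in; rewrite find_cat.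
  case: ifPn => [hasd|nhas] /=.
    have -> : (find (fun b0 : seq nat => d \in b0) b1 == size b1) = false.
      by apply/negbTE; rewrite neq_ltn -has_find hasd.
    apply/esym/negbTE; apply: contraL (hasd) => db.
    apply/hasPn => b' b'b1; apply: contra (dis d _); last by rewrite mem_cat db.
    by move=> db'; apply/flattenP; exists b'.
  by case: ifP => [|_]; rewrite ?addn0 ?eqxx // -[X in _ == X]addn0 eqn_add2l.
pose A (j : 'I_k) := [set d in divisor_set n | f (d : nat) == j].
have sumA j : \sum_(d in A j) (d : nat) = T.
  rewrite (sum_divisors_subset n_gt0 (fun d => f d == j)).
  rewrite -(perm_big _ permb) /=.
  have jb : j < size bins by rewrite sizeb.
  have bE : bins = take j bins ++ nth [::] bins j :: drop j.+1 bins.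
    by rewrite -drop_nth // cat_take_drop.
  have stake : size (take j bins) = j by rewrite size_take jb.
  have := fP _ _ _ _ bE; rewrite stake => fj.
  rewrite -big_filter (eq_in_filter (a2 := mem (nth [::] bins j))); last first.
    by move=> d; apply: fj.
  have sub : perm_eq [seq d <- flatten bins | d \in nth [::] bins j]
      (nth [::] bins j).
    have := uniqb; rewrite {1}bE flatten_cat cat_uniq => /and3P[_ _].
    rewrite /= cat_uniq => /and3P[unj _ _].
    apply: uniq_perm => //; first by rewrite filter_uniq.
    move=> d; rewrite mem_filter andb_idr // => dj.
    by apply/flattenP; exists (nth [::] bins j); rewrite // mem_nth.
  rewrite (perm_big _ sub) /= -sumnE.
  have := congr1 (fun s => nth 0 s j) sumb.
  by rewrite (nth_map [::]) // nth_nseq ltn_ord.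
have f_lt d : d \in divisor_set n -> f (d : 'I_n.+1) < k.
  rewrite inE (dvdn_divisors _ n_gt0) -(perm_mem permb) => /flattenP[b bb db].
  by rewrite -sizeb -has_find; apply/hasP; exists b.
(* As T > 0 every block is nonempty, and [f] reads the index off any element; hence there are
   exactly k blocks. *)
have A_inj : injective A.
  move=> i j Aij; have [d dA]: exists d, d \in A i.
    apply/set0Pn; apply: contraTneq T_gt0 => A0.
    by rewrite -(sumA i) A0 big_set0.
  have := dA; rewrite {2}Aij !inE in dA * => /andP[_ /eqP fj].
  by move: dA => /andP[_ /eqP fi]; apply: val_inj; rewrite /= -fi -fj.
exists [set A j | j : 'I_k]; split.
- apply/and3P; split.
  + rewrite eqEsubset; apply/andP; split.
      apply/bigcupsP => _ /imsetP[j _ ->].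
      by apply/subsetP => d; rewrite inE => /andP[].
    apply/subsetP => d dn; apply/bigcupP; exists (A (Ordinal (f_lt d dn))).
      exact: imset_f.
    by rewrite inE dn /=.
  + apply/trivIsetP => _ _ /imsetP[i _ ->] /imsetP[j _ ->] Aij.
    rewrite -setI_eq0; apply: contraNT Aij => /set0Pn[d].
    rewrite !inE => /andP[/andP[_ /eqP fi] /andP[_ /eqP fj]].
    by apply/eqP; congr A; apply: val_inj; rewrite /= -fi -fj.
  + apply/negP => /imsetP[j _ A0]; move: T_gt0.
    by rewrite -(sumA j) -A0 big_set0.
- by rewrite card_imset // card_ord.
- by move=> _ _ /imsetP[i _ ->] /imsetP[j _ ->]; rewrite !sumA.
Qed.

(** * The sum of divisors *)

(** A divisor of p^e m is p^i times a number prime to p, which divides m by Gauss's lemma; the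
    p-adic valuation recovers i, so no product occurs twice. *)
Lemma perm_divisors_primeX p e m : prime p -> 0 < m -> ~~ (p %| m) ->
  perm_eq (divisors (p ^ e * m))
          [seq p ^ i * d | i <- iota 0 e.+1, d <- divisors m].
Proof.
move=> p_pr m_gt0 pNm; have p_gt0 := prime_gt0 p_pr.
have logE i d : d %| m -> logn p (p ^ i * d) = i.
  move=> dm; have d_gt0 : 0 < d by apply: dvdn_gt0 dm.
  rewrite lognM ?expn_gt0 ?p_gt0 // pfactorK // -[RHS]addn0; congr (_ + _).
  apply/eqP; rewrite -leqn0 leqNgt logn_gt0 mem_primes p_pr d_gt0 /=.
  by apply: contra pNm => /dvdn_trans; apply.
apply: uniq_perm; first exact: divisors_uniq.
- apply: allpairs_uniq; rewrite ?iota_uniq ?divisors_uniq //.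
  move=> x y /allpairsP[[i d] [_ dm ->]] /allpairsP[[j b] [_ bm ->]] /= eq.
  move: dm bm; rewrite /= -!dvdn_divisors // => dm bm.
  have ij : i = j by rewrite -(logE i d dm) eq logE.
  move/eqP: eq; rewrite ij eqn_pmul2l ?expn_gt0 ?p_gt0 //.
  by move=> /eqP ->.
move=> d; rewrite -dvdn_divisors ?muln_gt0 ?expn_gt0 ?p_gt0 //.
apply/idP/allpairsP => [dn|[[i b] [i_le bm ->]]]; last first.
  have {}i_le : i \in iota 0 e.+1 := i_le.
  move: bm i_le; rewrite -dvdn_divisors // mem_iota ltnS => bm i_le.
  by rewrite dvdn_mul // dvdn_exp2l.
have d_gt0 : 0 < d.
  by apply: dvdn_gt0 dn; rewrite muln_gt0 expn_gt0 p_gt0.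
exists (logn p d, d %/ p ^ logn p d); rewrite [_.1]/= [_.2]/=.
rewrite mem_iota ltnS -dvdn_divisors // [_ * (_ %/ _)]mulnC.
rewrite divnK ?pfactor_dvdnn //; split=> //.
- rewrite -(logE e m (dvdnn m)); apply: dvdn_leq_log => //.
  by rewrite muln_gt0 expn_gt0 p_gt0.
- have cop : coprime (d %/ p ^ logn p d) (p ^ e).
    rewrite coprime_sym coprimeXl // prime_coprime //.
    apply/negP => pd; have: p ^ (logn p d).+1 %| d.
      by rewrite expnS -dvdn_divRL ?pfactor_dvdnn.
    by rewrite pfactor_dvdn // ltnn.
  rewrite -(Gauss_dvdr _ cop); apply: dvdn_trans dn.
  by apply: dvdn_div; apply: pfactor_dvdnn.
Qed.

(** For p prime this is sigma(p^e). *)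
Definition geom p e := \sum_(i < e.+1) p ^ i.

Lemma geom0 p : geom p 0 = 1.
Proof. by rewrite /geom big_ord1. Qed.

Lemma geomS p e : geom p e.+1 = geom p e * p + 1.
Proof.
rewrite /geom big_ord_recl addnC big_distrl /=; congr (_ + _).
by apply: eq_bigr => i _; rewrite /= expnSr.
Qed.

Lemma geom_gt0 p e : 0 < geom p e.
Proof. by rewrite /geom big_ord_recl. Qed.

(** From (p - 1) geom p e = p^(e+1) - 1; for p prime it means I(p^e) < p / (p - 1). *)
Lemma geom_lt p e : 1 < p -> geom p e * p.-1 < p ^ e.+1.
Proof. by move=> p_gt1; rewrite mulnC /geom -predn_exp; lia. Qed.

Lemma sigma_primeX p e m : prime p -> 0 < m -> ~~ (p %| m) ->
  sigma (p ^ e * m) = geom p e * sigma m.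
Proof.
move=> p_pr m_gt0 pNm; rewrite /sigma (perm_big _ (perm_divisors_primeX e p_pr m_gt0 pNm)).
rewrite big_allpairs_dep /geom -(big_mkord xpredT (fun i => p ^ i)) big_distrl.
by apply: eq_bigr => i _; rewrite big_distrr.
Qed.

Lemma sigma1 : sigma 1 = 1.
Proof. by rewrite /sigma big_seq1. Qed.

(** Write m = q^e n with q not dividing n; what remains is q geom q e + 1 <= (q + 1) geom q e. *)
Lemma sigma_mul_prime q m : prime q -> 0 < m ->
  sigma (q * m) <= q.+1 * sigma m.
Proof.
move=> q_pr m_gt0; have [n qn mE] := pfactor_coprime q_pr m_gt0.
move: (logn q m) mE => e mE; rewrite prime_coprime // in qn.
have n_gt0 : 0 < n by move: m_gt0; rewrite mE muln_gt0 => /andP[].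
have -> : q * m = q ^ e.+1 * n by rewrite mE expnS; ring.
rewrite mE [n * _]mulnC !sigma_primeX // mulnA leq_mul2r geomS.
by have := geom_gt0 q e; nia.
Qed.

(* [t] is the number of prime factors of [r], with multiplicity. *)
Lemma rough_sigma Q r : 0 < Q -> 0 < r ->
  (forall q, prime q -> q %| r -> Q <= q) ->
  exists t, [/\ Q ^ t <= r, sigma r * Q ^ t <= r * Q.+1 ^ t & t = 0 -> r = 1].
Proof.
move=> Q_gt0; elim/ltn_ind: r => r IH r_gt0 rough.
have [r1|r_gt1] := leqP r 1.
  have -> : r = 1 by lia.
  by exists 0; rewrite sigma1 !expn0.
have [q q_pr qr] : exists2 q, prime q & q %| r.
  by exists (pdiv r); rewrite ?pdiv_prime ?pdiv_dvd.
have /dvdnP[m rE] := qr; have q_gt1 := prime_gt1 q_pr.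
have m_gt0 : 0 < m by move: r_gt0; rewrite rE muln_gt0 => /andP[].
have Qq : Q <= q by apply: rough.
have [||t [Qt st _]] := IH m _ m_gt0.
- by rewrite rE ltn_Pmulr.
- by move=> p p_pr pm; apply: rough => //; rewrite rE dvdn_mulr.
exists t.+1; split=> //; first by rewrite expnSr rE leq_mul.
rewrite !expnS rE [m * q]mulnC.
apply: leq_trans (leq_mul (sigma_mul_prime q_pr m_gt0) (leqnn _)) _.
have -> : q.+1 * sigma m * (Q * Q ^ t) = (q.+1 * Q) * (sigma m * Q ^ t) by ring.
have -> : q * m * (Q.+1 * Q.+1 ^ t) = (q * Q.+1) * (m * Q.+1 ^ t) by ring.
(* Here (q + 1) Q <= q (Q + 1) because Q <= q. *)
by apply: leq_mul st; nia.
Qed.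

(** * Minimality *)

(* [D] is the common denominator of the fixed-point numerals. *)
Definition fix_val (D x : N) : rat := ((N.to_nat x)%:R / (N.to_nat D)%:R)%R.

(** The square root of y / D is sqrt(y D) / D; j iterations give the root of order 2^j, rounded down
    here and up in [root_hi]. *)
Definition root_lo (D : N) j (x : N) : N := iter j (fun y => N.sqrt (y * D)) x.
Definition root_hi (D : N) j (x : N) : N := iter j (fun y => N.sqrt (y * D) + 1)%num x.

Section FixedPoint.
Local Open Scope ring_scope.

Lemma fix_val_ge0 D x : 0 <= fix_val D x.
Proof. by rewrite /fix_val divr_ge0 ?ler0n. Qed.

Lemma natr_Nmul x y : (N.to_nat (x * y))%:R = (N.to_nat x)%:R * (N.to_nat y)%:R :> rat.
Proof. by rewrite -natrM; congr _%:R; lia. Qed.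

Lemma natr_Nle x y : ((N.to_nat x)%:R <= (N.to_nat y)%:R :> rat) = (x <=? y)%num.
Proof. by rewrite ler_nat; lia. Qed.

Lemma natr_Nlt x y : ((N.to_nat x)%:R < (N.to_nat y)%:R :> rat) = (x <? y)%num.
Proof. by rewrite ltr_nat; lia. Qed.

Lemma natr_Ngt0 x : (0 <? x)%num -> 0 < (N.to_nat x)%:R :> rat.
Proof. by rewrite -natr_Nlt. Qed.

Lemma natr_Ndiv_le x y : (0 <? y)%num ->
  (N.to_nat (x / y))%:R <= (N.to_nat x)%:R / (N.to_nat y)%:R :> rat.
Proof.
move=> y_gt0; rewrite ler_pdivlMr ?natr_Ngt0 // -natr_Nmul natr_Nle.
by have := N.Div0.mul_div_le x y; lia.
Qed.

Lemma natr_Ndiv_ge x y : (0 <? y)%num ->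
  (N.to_nat x)%:R / (N.to_nat y)%:R <= (N.to_nat (x / y + 1))%:R :> rat.
Proof.
move=> y_gt0; rewrite ler_pdivrMr ?natr_Ngt0 // -natr_Nmul natr_Nle.
by have := N.mul_succ_div_gt x y; lia.
Qed.

Lemma fix_val1 D : (0 <? D)%num -> fix_val D D = 1.
Proof. by move=> D_gt0; rewrite /fix_val divff // gt_eqF ?natr_Ngt0. Qed.

Lemma fix_val_le D x y : (0 <? D)%num -> (fix_val D x <= fix_val D y) = (x <=? y)%num.
Proof.
by move=> D0; rewrite /fix_val ler_pM2r ?natr_Nle // invr_gt0 natr_Ngt0.
Qed.

Lemma fix_val_mul D x y : (0 <? D)%num ->
  fix_val D x * fix_val D y = (N.to_nat (x * y))%:R / (N.to_nat D)%:R / (N.to_nat D)%:R.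
Proof. by move=> D0; rewrite natr_Nmul /fix_val; ring. Qed.

Lemma fix_val_mul_lo D x y : (0 <? D)%num ->
  fix_val D (x * y / D) <= fix_val D x * fix_val D y.
Proof.
move=> D0; rewrite fix_val_mul // [leLHS]/fix_val ler_pM2r ?natr_Ndiv_le //.
by rewrite invr_gt0 natr_Ngt0.
Qed.

Lemma fix_val_mul_hi D x y : (0 <? D)%num ->
  fix_val D x * fix_val D y <= fix_val D (x * y / D + 1).
Proof.
move=> D0; rewrite fix_val_mul // [leRHS]/fix_val ler_pM2r ?natr_Ndiv_ge //.
by rewrite invr_gt0 natr_Ngt0.
Qed.

Lemma root_lo_le D j x : (0 <? D)%num ->
  fix_val D (root_lo D j x) ^+ (2 ^ j)%N <= fix_val D x.
Proof.
move=> D0; elim: j => [|j IH]; first by rewrite expr1.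
apply: le_trans IH; rewrite expnS exprM lerXn2r ?nnegrE ?exprn_ge0 ?fix_val_ge0 //.
rewrite /root_lo iterS -/(root_lo D j x); move: (root_lo D j x) => y.
rewrite expr2 fix_val_mul // /fix_val ler_pM2r ?invr_gt0 ?natr_Ngt0 //.
rewrite ler_pdivrMr ?natr_Ngt0 // -natr_Nmul natr_Nle.
by have := N.sqrt_spec' (y * D); lia.
Qed.

Lemma root_hi_ge D j x : (0 <? D)%num ->
  fix_val D x <= fix_val D (root_hi D j x) ^+ (2 ^ j)%N.
Proof.
move=> D0; elim: j => [|j IH]; first by rewrite expr1.
apply: le_trans IH _; rewrite expnS exprM lerXn2r ?nnegrE ?exprn_ge0 ?fix_val_ge0 //.
rewrite /root_hi iterS -/(root_hi D j x); move: (root_hi D j x) => y.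
rewrite expr2 fix_val_mul // /fix_val ler_pM2r ?invr_gt0 ?natr_Ngt0 //.
rewrite ler_pdivlMr ?natr_Ngt0 // -natr_Nmul natr_Nle.
by have := N.sqrt_spec' (y * D); lia.
Qed.

Lemma root_lo_ge1 D j x : (D <=? x)%num -> (D <=? root_lo D j x)%num.
Proof.
move=> Dx; elim: j => [|j IH] //; rewrite /root_lo iterS -/(root_lo D j x).
move: (root_lo D j x) IH => y Dy.
have : (N.sqrt (D * D) <= N.sqrt (y * D))%num by apply: N.sqrt_le_mono; nia.
by rewrite N.sqrt_square; lia.
Qed.

End FixedPoint.

(* An upper bound for the maximum over e of I(p^e) / h^e; past the fuel it uses
   I(p^e) < p / (p - 1) and the monotonicity of h^e. *)
Fixpoint peak (D p h : N) fuel (q s l M : N) : N :=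
  if fuel is n.+1 then
    peak D p h n (q * p) (s * p + 1) (l * h / D)
      (N.max M (s * D * D / (q * l) + 1))
  else N.max M (p * D * D / ((p - 1) * l) + 1).

Lemma peak_ge D p h fuel q s l M : (M <=? peak D p h fuel q s l M)%num.
Proof.
elim: fuel q s l M => [|n IH] q s l M /=; first by lia.
by have := IH (q * p)%num (s * p + 1)%num (l * h / D)%num
  (N.max M (s * D * D / (q * l) + 1))%num; lia.
Qed.

Section Peak.
Local Open Scope ring_scope.

(** Dividing a / b by the value l / D gives a D^2 / (b l) in units of 1 / D; adding 1 to the integer
    quotient rounds it up. *)
Lemma ratio_hi D a b l M : (0 <? D)%num -> (0 <? b)%num -> (0 <? l)%num ->
  (a * D * D / (b * l) + 1 <=? M)%num ->
  (N.to_nat a)%:R <= fix_val D M * fix_val D l * (N.to_nat b)%:R.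
Proof.
move=> D0 b0 l0; rewrite -natr_Nle.
have bl0 : (0 <? b * l)%num by lia.
move/(le_trans (natr_Ndiv_ge (a * D * D) bl0)).
rewrite !natr_Nmul ler_pdivrMr ?mulr_gt0 ?natr_Ngt0 // => le1.
have DD0 : 0 < (N.to_nat D)%:R * (N.to_nat D)%:R :> rat by rewrite mulr_gt0 ?natr_Ngt0.
have D_neq0 : (N.to_nat D)%:R != 0 :> rat by rewrite gt_eqF ?natr_Ngt0.
rewrite -(ler_pM2r DD0) mulrA; apply: le_trans le1 _.
by rewrite le_eqVlt; apply/orP; left; apply/eqP; rewrite /fix_val; field.
Qed.

(** [e0] is the exponent reached by the recursion. If it meets [e] within the fuel, the ratio at [e]
    enters the running maximum and stays there by [peak_ge]. Otherwise I(p^e) < p / (p - 1) and h^e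
    >= h^e0 >= l suffice, since h >= 1. *)
Lemma peakP D p h fuel e0 q s l M e :
  (0 <? D)%num -> (1 <? p)%num -> (D <=? h)%num -> (D <=? l)%num ->
  N.to_nat q = (N.to_nat p ^ e0)%N -> N.to_nat s = geom (N.to_nat p) e0 ->
  fix_val D l <= fix_val D h ^+ e0 -> (e0 <= e)%N ->
  (geom (N.to_nat p) e)%:R <=
    fix_val D (peak D p h fuel q s l M) * fix_val D h ^+ e * (N.to_nat p ^ e)%N%:R.
Proof.
move=> D0 p1 Dh; have p0 : (0 <? p)%num by lia.
have h1 : 1 <= fix_val D h by rewrite -(fix_val1 D0) fix_val_le.
have pe0 i : 0 < (N.to_nat p ^ i)%N%:R :> rat by rewrite ltr0n expn_gt0; lia.
elim: fuel e0 q s l M => [|n IH] e0 q s l M Dl qE sE lh e0e.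
  set T := peak _ _ _ _ _ _ _ _; have l0 : (0 <? l)%num by lia.
  have pm0 : (0 <? (p - 1))%num by lia.
  have TP : (N.to_nat p)%:R <= fix_val D T * fix_val D l * (N.to_nat (p - 1))%:R.
    by apply: ratio_hi => //; rewrite /T /=; lia.
  have gP : (geom (N.to_nat p) e)%:R * (N.to_nat (p - 1))%:R <=
      (N.to_nat p)%:R * (N.to_nat p ^ e)%N%:R :> rat.
    rewrite -!natrM ler_nat -expnS; have -> : N.to_nat (p - 1) = (N.to_nat p).-1 by lia.
    by apply/ltnW/geom_lt; lia.
  have lhe : fix_val D l <= fix_val D h ^+ e.
    by apply: le_trans lh _; apply: ler_weXn2l.
  rewrite -(ler_pM2r (natr_Ngt0 pm0)); apply: le_trans gP _.
  rewrite mulrAC ler_pM2r //; apply: le_trans TP _.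
  by rewrite ler_pM2r ?natr_Ngt0 // ler_wpM2l ?fix_val_ge0.
have [e0E|e0_neq] := eqVneq e0 e.
  set T := peak _ _ _ _ _ _ _ _; have l0 : (0 <? l)%num by lia.
  have q0 : (0 <? q)%num by move: (pe0 e0); rewrite -qE ltr0n; lia.
  have := @ratio_hi D s q l T D0 q0 l0; rewrite sE qE -e0E => H.
  apply: le_trans (H _) _.
    rewrite /T /=; set M' := N.max _ _.
    by have := peak_ge D p h n (q * p) (s * p + 1) (l * h / D) M'; rewrite /M'; lia.
  by rewrite ler_pM2r // ler_wpM2l ?fix_val_ge0.
apply: (IH e0.+1); last by rewrite ltn_neqAle e0_neq.
- suff : (D <= l * h / D)%num by lia.
  by apply: N.div_le_lower_bound; nia.
- by rewrite expnSr -qE; lia.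
- by rewrite geomS -sE; lia.
- apply: le_trans (fix_val_mul_lo _ _ D0) _.
  by rewrite exprSr ler_wpM2r ?fix_val_ge0.
Qed.
End Peak.

Arguments peak : simpl never.

(* Here eps = B / 2^j; each prime p comes with h <= p^eps and an upper bound C of
   I(r) / r^eps over the r all of whose prime factors are at least p. *)
Fixpoint bound_table (D B : N) j (ps : seq N) : seq (N * N * N) * N :=
  if ps is p :: ps' then
    let: (l, C) := bound_table D B j ps' in
    let h := root_lo D j (p ^ B * D) in
    let C' := (C * peak D p h 12 1 1 D 0 / D + 1)%num in
    ((p, h, C') :: l, C')
  else ([::], D).

(* If m = u r where r has t prime factors, all at least Q, then m < g and
   I(m) >= k give u Q^t < g and k u Q^t <= s (Q + 1)^t, where s = sigma u. *)
Fixpoint leaf_pow (k g Q : N) fuel (a b : N) : bool :=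
  if (g <=? a)%num then true else
  if fuel is n.+1 then
    if (b <? k * a)%num then leaf_pow k g Q n (a * Q) (b * (Q + 1)) else false
  else false.

(** The case t = 0, where m = u, is tested on its own; only there does divisibility by k enter.
    [leaf_pow] then starts from t = 1. *)
Definition leaf (k g Q : N) fuel (u s : N) : bool :=
  if ((g <=? u) || (s <? k * u) || negb (s mod k =? 0))%num
  then leaf_pow k g Q fuel (u * Q) (s * (Q + 1)) else false.

(** The exponents e = 0, 1, ... of p are tried in turn: [u] carries the factor p^e, [t] is
    sigma(p^e), and [H] stays a lower bound for u^eps because products are rounded down. *)
Fixpoint power_loop (rec : N -> N -> N -> bool) (D g p h s : N) fuel (u t H : N) :=
  if (g <=? u)%num then true else
  if fuel is n.+1 then
    if rec u (s * t)%num H then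
      power_loop rec D g p h s n (u * p) (t * p + 1) (H * h / D)
    else false
  else false.

(* [u] is the part of m already chosen, [s] = sigma u, H <= u^eps and
   G >= g^eps. *)
Fixpoint no_good (D k g G Q : N) fuel (l : seq (N * N * N)) (u s H : N) : bool :=
  if l is (p, h, C) :: l' then
    if (s * C * G <? k * u * H * D)%num then true else
    power_loop (no_good D k g G Q fuel l') D g p h s fuel u 1 H
  else leaf k g Q fuel u s.

(** The first test says 1 + 1/Q <= Q^eps, which allows [bound_table] to start from the constant 1
    for numbers without prime factors below Q. All roundings go in the safe direction, so the
    parameters decide only whether the search succeeds. *)
Definition search (D k g B : N) (Q j : nat) : bool :=
  let ps := [seq N.of_nat p | p <- iota 0 Q & prime p] in
  let q := N.of_nat Q in
  ((0 <? D) && (D * (q + 1) <=? root_lo D j (q ^ B * D) * q))%num &&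
  no_good D k g (root_hi D j (g ^ B * D)) q 200 (bound_table D B j ps).1 1 1 D.

Definition rough_above (Q : nat) (l : seq (N * N * N)) r :=
  0 < r /\ forall q, prime q -> q %| r ->
    q \in [seq N.to_nat x.1.1 | x <- l] \/ Q <= q.

Section Bounds.
Local Open Scope ring_scope.

(** The possibly irrational r^eps is replaced by a rational x with x^(2^j) <= r^B, that is, x <=
    r^eps. *)
Definition rough_bound (D B : N) j Q l (C : N) :=
  forall r, rough_above Q l r -> exists x : rat,
    [/\ 0 <= x, x ^+ (2 ^ j)%N <= r%:R ^+ N.to_nat B &
        (sigma r)%:R <= fix_val D C * x * r%:R].

Fixpoint valid_table (D B : N) j Q (l : seq (N * N * N)) : Prop :=
  if l is (p, h, C) :: l' then
    [/\ prime (N.to_nat p),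
        fix_val D h ^+ (2 ^ j)%N <= (N.to_nat p)%:R ^+ N.to_nat B,
        rough_bound D B j Q l C & valid_table D B j Q l']
  else True.

(** If r has t prime factors, take x = (1 + 1/Q)^t: then I(r) <= x by [rough_sigma], and x <= Q^(t
    eps) <= r^eps. *)
Lemma rough_bound_nil D B j Q : (0 <? D)%num -> (0 < Q)%N ->
  (D * (N.of_nat Q + 1) <=? root_lo D j (N.of_nat Q ^ B * D) * N.of_nat Q)%num ->
  rough_bound D B j Q [::] D.
Proof.
move=> D0 Q0 DQ r [r0 rough].
have [t [Qt st _]] : exists t, [/\ (Q ^ t <= r)%N,
    (sigma r * Q ^ t <= r * Q.+1 ^ t)%N & t = 0%N -> r = 1%N].
  by apply: rough_sigma => // q q_pr /(rough q q_pr) [].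
have Qpos : 0 < Q%:R :> rat by rewrite ltr0n.
pose y : rat := Q.+1%:R / Q%:R; have y0 : 0 <= y by rewrite divr_ge0 ?ler0n.
exists (y ^+ t); split; first exact: exprn_ge0.
- have yQ : y ^+ (2 ^ j)%N <= Q%:R ^+ N.to_nat B.
    apply: (@le_trans _ _ (fix_val D (root_lo D j (N.of_nat Q ^ B * D)) ^+ (2 ^ j)%N)).
      rewrite lerXn2r ?nnegrE ?fix_val_ge0 // /y ler_pdivrMr //.
      rewrite /fix_val mulrAC ler_pdivlMr ?natr_Ngt0 // -natrM -natrM ler_nat; lia.
    apply: le_trans (root_lo_le _ _ D0) _.
    rewrite /fix_val ler_pdivrMr ?natr_Ngt0 // -natrX -natrM ler_nat; lia.
  rewrite -exprM mulnC exprM; apply: (@le_trans _ _ ((Q%:R ^+ N.to_nat B) ^+ t)).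
    by rewrite lerXn2r ?nnegrE ?exprn_ge0 ?ler0n.
  rewrite -exprM mulnC exprM lerXn2r ?nnegrE ?exprn_ge0 ?ler0n //.
  by rewrite -natrX ler_nat.
- rewrite fix_val1 // mul1r /y expr_div_n mulrAC ler_pdivlMr ?exprn_gt0 //.
  by rewrite -!natrX -!natrM ler_nat mulnC [(_ * r)%N]mulnC mulnC.
Qed.

Lemma rough_split Q p h C l r : prime (N.to_nat p) ->
  rough_above Q ((p, h, C) :: l) r ->
  exists e r', [/\ r = (N.to_nat p ^ e * r')%N, ~~ (N.to_nat p %| r')%N &
    rough_above Q l r'].
Proof.
move=> p_pr [r0 rough]; have [r' pr' rE] := pfactor_coprime p_pr r0.
rewrite prime_coprime // in pr'.
exists (logn (N.to_nat p) r), r'; rewrite mulnC; split=> //; split.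
  by move: r0; rewrite {1}rE muln_gt0 => /andP[].
move=> q q_pr qr'; have [||] := rough q q_pr.
- by rewrite rE dvdn_mulr.
- rewrite inE => /orP[/eqP qp|]; last by left.
  by rewrite -[N.to_nat p]qp qr' in pr'.
- by right.
Qed.

(** By multiplicativity: for r = p^e r' with p not dividing r', the witness is h^e times that of r',
    and the constant of r' is multiplied by the peak at p. *)
Lemma valid_bound_table D B j Q ps : (0 <? D)%num ->
  rough_bound D B j Q [::] D -> all (fun p => prime (N.to_nat p)) ps ->
  let: (l, C) := bound_table D B j ps in
  [/\ valid_table D B j Q l, rough_bound D B j Q l C &
      [seq x.1.1 | x <- l] = ps].
Proof.
move=> D0 nilP; elim: ps => [//|p ps IH] /= /andP[p_pr /IH].
case: (bound_table D B j ps) => l C [valid_l boundC ps_l].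
set h := root_lo _ _ _; set M := peak _ _ _ _ _ _ _ _; set C' := (_ + 1)%num.
have p_gt1 := prime_gt1 p_pr.
have hp : fix_val D h ^+ (2 ^ j)%N <= (N.to_nat p)%:R ^+ N.to_nat B.
  apply: le_trans (root_lo_le _ _ D0) _.
  rewrite /fix_val ler_pdivrMr ?natr_Ngt0 // -natrX -natrM ler_nat; lia.
have Dh : (D <=? h)%num.
  apply: root_lo_ge1; have : (p ^ B <> 0)%num by apply: N.pow_nonzero; lia.
  by nia.
suff boundC' : rough_bound D B j Q ((p, h, C') :: l) C'.
  by split=> //=; rewrite ps_l.
move=> r /(rough_split p_pr)[e [r' [-> pr' r'P]]].
have [x [x0 xr' sx]] := boundC _ r'P; have [r'0 _] := r'P.
exists (fix_val D h ^+ e * x); split.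
- by rewrite mulr_ge0 ?exprn_ge0 ?fix_val_ge0.
- rewrite [leLHS]exprMn natrM [leRHS]exprMn ler_pM ?exprn_ge0 ?fix_val_ge0 //.
  rewrite -exprM mulnC exprM natrX -[leRHS]exprM mulnC [leRHS]exprM.
  by rewrite lerXn2r ?nnegrE ?exprn_ge0 ?fix_val_ge0 ?ler0n.
rewrite sigma_primeX // !natrM.
have ge : (geom (N.to_nat p) e)%:R <=
    fix_val D M * fix_val D h ^+ e * (N.to_nat p ^ e)%N%:R.
  apply: (@peakP D p h 12 0) => //; rewrite ?geom0 ?expr0 ?fix_val1 //; lia.
have CM := fix_val_mul_hi C M D0; rewrite -/C' in CM.
apply: le_trans (ler_pM _ _ ge sx) _; rewrite ?ler0n //.
set P := (N.to_nat p ^ e)%N%:R; set H := fix_val D h ^+ e.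
have -> : fix_val D M * H * P * (fix_val D C * x * r'%:R) =
    (fix_val D C * fix_val D M) * (H * x * (P * r'%:R)) by ring.
rewrite -[leRHS]mulrA ler_wpM2r // !mulr_ge0 ?exprn_ge0 ?fix_val_ge0 ?ler0n //.
Qed.

(* The pruning test: [x] times the value of [H] bounds m ^ eps <= g ^ eps. *)
Lemma prune D B j k g G u s H C r : (0 <? D)%num -> (0 < r)%N ->
  (N.to_nat g)%:R ^+ N.to_nat B <= fix_val D G ^+ (2 ^ j)%N ->
  fix_val D H ^+ (2 ^ j)%N <= (N.to_nat u)%:R ^+ N.to_nat B ->
  (exists x : rat, [/\ 0 <= x, x ^+ (2 ^ j)%N <= r%:R ^+ N.to_nat B &
        (sigma r)%:R <= fix_val D C * x * r%:R]) ->
  (s * C * G <? k * u * H * D)%num ->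
  (N.to_nat u * r < N.to_nat g)%N ->
  (N.to_nat k * (N.to_nat u * r) <= N.to_nat s * sigma r)%N -> False.
Proof.
move=> D0 r0 gG Hu [x [x0 xr sx]] test ur_g good.
(* Compared through 2^j-th powers, where it follows from r^B u^B <= g^B. *)
have xHG : x * fix_val D H <= fix_val D G.
  have xH0 : 0 <= x * fix_val D H by apply: mulr_ge0 => //; apply: fix_val_ge0.
  have G0 := fix_val_ge0 D G.
  rewrite -(@ler_pXn2r _ (2 ^ j)%N) ?expn_gt0 ?nnegrE //.
  apply: le_trans gG; rewrite exprMn.
  apply: (@le_trans _ _ (r%:R ^+ N.to_nat B * (N.to_nat u)%:R ^+ N.to_nat B)).
    by rewrite ler_pM ?exprn_ge0 ?fix_val_ge0.
  rewrite -exprMn lerXn2r ?nnegrE ?mulr_ge0 ?ler0n // -natrM ler_nat mulnC.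
  exact: ltnW.
have rpos : 0 < r%:R :> rat by rewrite ltr0n.
have kus : (N.to_nat k)%:R * (N.to_nat u)%:R <= (N.to_nat s)%:R * (fix_val D C * x).
  rewrite -(ler_pM2r rpos); apply: (@le_trans _ _ ((N.to_nat s)%:R * (sigma r)%:R)).
    by rewrite -!natrM ler_nat -mulnA.
  by rewrite -[leRHS]mulrA ler_wpM2l ?ler0n.
have : (N.to_nat k)%:R * (N.to_nat u)%:R * fix_val D H <=
    (N.to_nat s)%:R * fix_val D C * fix_val D G.
  apply: le_trans (ler_wpM2r (fix_val_ge0 D H) kus) _.
  have -> : (N.to_nat s)%:R * (fix_val D C * x) * fix_val D H =
    (N.to_nat s)%:R * fix_val D C * (x * fix_val D H) by ring.
  by apply: ler_wpM2l => //; rewrite mulr_ge0 ?fix_val_ge0 ?ler0n.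
have Dpos := natr_Ngt0 D0; have D_neq0 : (N.to_nat D)%:R != 0 :> rat by rewrite gt_eqF.
rewrite -(ler_pM2r (mulr_gt0 Dpos Dpos)) leNgt => /negP; apply.
move: test; rewrite -natr_Nlt !natr_Nmul /fix_val => test.
have -> : (N.to_nat s)%:R * ((N.to_nat C)%:R / (N.to_nat D)%:R) *
   ((N.to_nat G)%:R / (N.to_nat D)%:R) * ((N.to_nat D)%:R * (N.to_nat D)%:R) =
   (N.to_nat s)%:R * (N.to_nat C)%:R * (N.to_nat G)%:R :> rat by field.
apply: lt_le_trans test _; rewrite le_eqVlt; apply/orP; left; apply/eqP; field.
exact: D_neq0.
Qed.

End Bounds.

(** The loop succeeds only once its first argument has reached g, so every t with a Q^t < g has been
    tested. *)
Lemma leaf_powP k g Q fuel a b t : (0 <? Q)%num -> leaf_pow k g Q fuel a b ->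
  N.to_nat a * N.to_nat Q ^ t < N.to_nat g ->
  N.to_nat b * (N.to_nat Q).+1 ^ t < N.to_nat k * (N.to_nat a * N.to_nat Q ^ t).
Proof.
move=> Q0; elim: fuel t a b => [|n IH] t a b /=; case: ifPn => // ga.
- have : 0 < N.to_nat Q ^ t by rewrite expn_gt0; lia.
  by nia.
- have : 0 < N.to_nat Q ^ t by rewrite expn_gt0; lia.
  by nia.
case: ifP => // ab; case: t => [|t]; first by rewrite !expn0; lia.
move=> /IH{}IH; rewrite !expnS.
have := IH t; have -> : N.to_nat (a * Q) = N.to_nat a * N.to_nat Q by lia.
have -> : N.to_nat (b * (Q + 1)) = N.to_nat b * (N.to_nat Q).+1 by lia.
by rewrite -!mulnA.
Qed.

Lemma leafP k g Q fuel u s r : 0 < Q -> leaf k g (N.of_nat Q) fuel u s ->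
  rough_above Q [::] r -> N.to_nat u * r < N.to_nat g ->
  N.to_nat k * (N.to_nat u * r) <= N.to_nat s * sigma r ->
  N.to_nat k %| N.to_nat s * sigma r -> False.
Proof.
move=> Q0; rewrite /leaf; case: ifP => // test1 test [r0 rough] ur_g good div.
have [t [Qt st t0]] : exists t, [/\ Q ^ t <= r,
    sigma r * Q ^ t <= r * Q.+1 ^ t & t = 0 -> r = 1].
  by apply: rough_sigma => // q q_pr /(rough q q_pr) [].
case: t => [|t] in Qt st t0.
  move: (t0 erefl) => r1; rewrite r1 sigma1 !muln1 in ur_g good div.
  move: test1; rewrite -orbA => /or3P[]; [lia|lia|].
  have /dvdnP[c sE] := div; have -> : s = (N.of_nat c * k)%num by lia.
  by rewrite N.Div0.mod_mul.
have QE : N.to_nat (N.of_nat Q) = Q by lia.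
have := leaf_powP (t := t) _ test; rewrite QE.
have -> : N.to_nat (u * N.of_nat Q) = N.to_nat u * Q by lia.
have -> : N.to_nat (s * (N.of_nat Q + 1)) = N.to_nat s * Q.+1 by lia.
rewrite -!mulnA -!expnS => /(_ _ _)/wrap[||lt]; first by lia.
  by apply: leq_ltn_trans ur_g; rewrite leq_mul2l Qt orbT.
have : N.to_nat k * (N.to_nat u * Q ^ t.+1) * r <= N.to_nat s * Q.+1 ^ t.+1 * r.
  have -> : N.to_nat k * (N.to_nat u * Q ^ t.+1) * r =
    N.to_nat k * (N.to_nat u * r) * Q ^ t.+1 by ring.
  apply: leq_trans (leq_mul good (leqnn _)) _.
  by rewrite -!mulnA leq_mul2l [_ * r]mulnC st orbT.
by rewrite leq_mul2r leqNgt lt orbF; lia.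
Qed.

(** With [bad] arbitrary, the recursion over the primes enters only through the hypothesis on [rec].
    Stopping at the first u >= g is harmless, since u0 p^e increases with e. *)
Lemma power_loopP (rec : N -> N -> N -> bool) (D B g p h s : N) j fuel e u0 u t H
    (bad : nat -> N -> N -> Prop) :
  (0 <? D)%num -> (1 <? p)%num ->
  (fix_val D h ^+ (2 ^ j) <= (N.to_nat p)%:R ^+ N.to_nat B)%R ->
  (forall u' s' H' r, (0 <? u')%num ->
     (fix_val D H' ^+ (2 ^ j) <= (N.to_nat u')%:R ^+ N.to_nat B)%R ->
     rec u' s' H' -> 0 < r -> N.to_nat u' * r < N.to_nat g ->
     bad r u' s' -> False) ->
  (0 <? u0)%num ->
  N.to_nat u = N.to_nat u0 * N.to_nat p ^ e -> N.to_nat t = geom (N.to_nat p) e ->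
  (fix_val D H ^+ (2 ^ j) <= (N.to_nat u)%:R ^+ N.to_nat B)%R ->
  power_loop rec D g p h s fuel u t H ->
  forall e' r, e <= e' -> 0 < r ->
    N.to_nat u0 * (N.to_nat p ^ e' * r) < N.to_nat g ->
    (forall u' s', N.to_nat u' = N.to_nat u0 * N.to_nat p ^ e' ->
       N.to_nat s' = N.to_nat s * geom (N.to_nat p) e' -> bad r u' s') -> False.
Proof.
move=> D0 p1 hp recP u00.
have large v e1 e2 r : e1 <= e2 -> 0 < r ->
    v * N.to_nat p ^ e1 <= v * (N.to_nat p ^ e2 * r).
  move=> e12 r0; rewrite leq_mul2l; apply/orP; right.
  by apply: leq_trans (leq_pmulr _ r0); rewrite leq_exp2l; lia.
elim: fuel e u t H => [|n IH] e u t H uE tE HP /=.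
  case: ifP => // gu _ e' r ee' r0 lt _; have := large (N.to_nat u0) _ _ _ ee' r0; lia.
case: ifP => [gu _ e' r ee' r0 lt _|gu].
  have := large (N.to_nat u0) _ _ _ ee' r0; lia.
case: ifP => // recu loop e' r ee' r0 lt badP.
have pe : 0 < N.to_nat p ^ e by rewrite expn_gt0; lia.
have [eE|e_neq] := eqVneq e e'.
  apply: (recP u (s * t)%num H r) => //; first by nia.
    by rewrite uE -mulnA eE.
  by apply: badP; rewrite -eE //; lia.
apply: (IH e.+1 (u * p)%num (t * p + 1)%num (H * h / D)%num _ _ _ loop e' r) => //.
- by rewrite expnSr mulnA -uE; lia.
- by rewrite geomS -tE; lia.
- apply: (@le_trans _ _ ((fix_val D H * fix_val D h) ^+ (2 ^ j))%R).
    rewrite lerXn2r ?nnegrE ?fix_val_mul_lo ?fix_val_ge0 //.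
    by apply: mulr_ge0; apply: fix_val_ge0.
  rewrite [leLHS]exprMn natr_Nmul [leRHS]exprMn ler_pM ?exprn_ge0 ?fix_val_ge0 //.
- by rewrite ltn_neqAle e_neq.
Qed.

(** Induction on the remaining primes. The products u r and s sigma(r) stand for m and sigma(m);
    moving p^e from r to u preserves both, by [sigma_primeX]. *)
Lemma no_goodP D B j k g G Q fuel l u s H : (0 <? D)%num -> 0 < Q ->
  ((N.to_nat g)%:R ^+ N.to_nat B <= fix_val D G ^+ (2 ^ j))%R ->
  valid_table D B j Q l -> (0 <? u)%num ->
  (fix_val D H ^+ (2 ^ j) <= (N.to_nat u)%:R ^+ N.to_nat B)%R ->
  no_good D k g G (N.of_nat Q) fuel l u s H ->
  forall r, rough_above Q l r -> N.to_nat u * r < N.to_nat g ->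
  N.to_nat k * (N.to_nat u * r) <= N.to_nat s * sigma r ->
  N.to_nat k %| N.to_nat s * sigma r -> False.
Proof.
move=> D0 Q0 gG; elim: l u s H => [|[[p h] C] l IH] u s H.
  by move=> _ u0 _ test r rP lt good div; apply: (leafP Q0 test rP lt good div).
move=> [p_pr hp boundC valid_l] u0 HP; rewrite [no_good _ _ _ _ _ _ _ _ _ _]/=.
case: ifP => [test _ r rP lt good _|_ loop r rP lt good div].
  have [r0 _] := rP.
  exact: (prune D0 r0 gG HP (boundC r rP) test lt good).
have [e [r' [rE pr' r'P]]] := rough_split p_pr rP; have [r'0 _] := r'P.
have p_gt1 := prime_gt1 p_pr.
pose bad r0 (u' s' : N) := [/\ rough_above Q l r0,
  N.to_nat k * (N.to_nat u' * r0) <= N.to_nat s' * sigma r0 &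
  N.to_nat k %| N.to_nat s' * sigma r0].
apply: (power_loopP (bad := bad) (B := B) D0 _ hp _ u0 _ _ HP loop (e := 0) (e' := e) (r := r')).
- by lia.
- move=> u' s' H' r0 u'0 H'P ru' _ lt' [r0P good' div'].
  exact: (IH u' s' H' valid_l u'0 H'P ru' r0 r0P lt' good' div').
- by rewrite expn0 muln1.
- by rewrite geom0.
- by [].
- by [].
- by rewrite -rE.
- move=> u' s' u'E s'E; rewrite /bad u'E s'E -!mulnA -sigma_primeX // -rE.
  by split.
Qed.

Lemma search_sound D k g B Q j : search D k g B Q j ->
  forall m, m < N.to_nat g -> ~ good_abundant (N.to_nat k) m.
Proof.
rewrite /search => /andP[/andP[D0 DQ] test] m m_g /good_abundantE[m0 good div].
have Q0 : 0 < Q by lia.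
have nilP := rough_bound_nil D0 Q0 DQ.
set ps := [seq _ | _ <- _ & _] in test.
have primes_ps : all (fun p => prime (N.to_nat p)) ps.
  apply/allP => _ /mapP[p + ->]; rewrite mem_filter => /andP[p_pr _].
  by have -> : N.to_nat (N.of_nat p) = p by lia.
have := valid_bound_table D0 nilP primes_ps; move: test.
case: (bound_table D B j ps) => l C /= test [valid_l _ lE].
apply: (no_goodP D0 Q0 _ valid_l _ _ test (r := m)) => //.
- have := root_hi_ge j (g ^ B * D) D0; apply: le_trans.
  rewrite /fix_val ler_pdivlMr ?natr_Ngt0 // -natrX -natrM ler_nat; lia.
- by rewrite fix_val1 // !expr1n.
- split=> // q q_pr _; have [?|qQ] := leqP Q q; [by right|left].
  have qE : q = N.to_nat (N.of_nat q) by lia.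
  rewrite (map_comp N.to_nat (fun x : N * N * N => x.1.1)) lE qE.
  apply: map_f; apply: map_f; rewrite mem_filter q_pr mem_iota; lia.
- by rewrite mul1n.
- by rewrite !mul1n.
- by rewrite mul1n.
Qed.

(** * Filling the bins *)

Lemma realizable_cons l d c1 x c2 : d <= x ->
  realizable l (c1 ++ (x - d) :: c2) -> realizable (d :: l) (c1 ++ x :: c2).
Proof.
move=> dx [bins permb sumb].
have lt1 : size c1 < size bins.
  by rewrite -(size_map sumn) sumb size_cat /=; lia.
have bE : bins = take (size c1) bins ++ nth [::] bins (size c1) :: drop (size c1).+1 bins.
  by rewrite -drop_nth // cat_take_drop.
set b1 := take _ _ in bE; set b := nth _ _ _ in bE; set b2 := drop _ _ in bE.
have sb1 : size b1 = size c1 by rewrite size_take lt1.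
move: sumb; rewrite bE map_cat /= => /eqP; rewrite eqseq_cat ?size_map //.
case/andP=> /eqP sum1 /eqP[sumb sum2].
exists (b1 ++ (d :: b) :: b2).
  apply: perm_trans (_ : perm_eq (d :: flatten bins) _); last by rewrite perm_cons.
  by rewrite bE !flatten_cat /= -cat_cons perm_catCA /= perm_cons perm_catCA.
by rewrite map_cat /= sum1 sumb sum2 subnKC.
Qed.

(** [R] is the sum of the items kept in reserve, so the right-hand side is the total capacity left
    when [d] is about to be placed. *)
Fixpoint room (k mu R : nat) (l : seq nat) : Prop :=
  if l is d :: l' then k * (d + mu) <= d + sumn l' + R /\ room k mu R l' else True.

Lemma max_capacity (c : seq nat) b : b * size c <= sumn c -> 0 < size c ->
  exists2 x, x \in c & b <= x.
Proof.
move=> bc c0; have [/hasP[x xc bx]|/hasPn nb] := boolP (has (leq b) c).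
  by exists x.
suff : sumn c < b * size c by rewrite ltnNge bc.
elim: c {bc} c0 nb => //= x c IH _ nb.
have xb : x < b by rewrite ltnNge nb ?inE ?eqxx.
case: c IH nb => [|y c] IH nb; first by rewrite /= muln1 addn0.
rewrite mulnS; apply: leq_ltn_trans (leq_add (leqnn x) (ltnW (IH _ _))) _ => //.
  by move=> z zc; apply: nb; rewrite inE zc orbT.
by rewrite ltn_add2r.
Qed.

(* Putting the largest remaining item in the bin of largest remaining capacity
   leaves at least [mu] in that bin, since the average is at least [d + mu]. *)
Lemma greedy k mu res l : 0 < k ->
  (forall c, size c = k -> all (leq mu) c -> sumn c = sumn res -> realizable res c) ->
  room k mu (sumn res) l ->
  forall c, size c = k -> all (leq mu) c -> sumn c = sumn l + sumn res ->
  realizable (l ++ res) c.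
Proof.
move=> k0 resP; elim: l => [|d l IH] /=; first by move=> _; apply: resP.
move=> [room_d /IH{}IH] c ck cmu sumc.
have [||x xc dx] := @max_capacity c (d + mu); rewrite ?ck //.
  by rewrite sumc mulnC.
case/splitPr: xc ck cmu sumc => c1 c2 ck cmu sumc.
apply: realizable_cons; first by lia.
apply: IH.
- by move: ck; rewrite !size_cat.
- move: cmu; rewrite !all_cat /= => /and3P[-> _ ->] /=; rewrite andbT; lia.
- move: sumc; rewrite !sumn_cat /=; lia.
Qed.

(** In a decreasing list the entries at most d are d and those after it. *)
Lemma room_sorted k mu R l : sorted gtn l ->
  (forall d, d \in l -> k * (d + mu) <= \sum_(e <- l | e <= d) e + R) ->
  room k mu R l.
Proof.
elim: l => //= d l IH pl dP.
have lt_d e : e \in l -> e < d.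
  have gtn_tr : transitive gtn by move=> y x z /= yx zy; apply: ltn_trans zy yx.
  by have /allP := order_path_min gtn_tr pl; apply.
split.
  have := dP d; rewrite inE eqxx big_cons leqnn => /(_ isT) h.
  apply: leq_trans h _; rewrite leq_add2r leq_add2l sumnE.
  by rewrite big_mkcond leq_sum // => i _; case: ifP.
apply: IH; first exact: path_sorted pl.
move=> e el; have := dP e; rewrite inE el orbT big_cons [d <= e]leqNgt lt_d //=.
exact.
Qed.

Lemma layered_greedy k mu n T D0 res : 0 < n -> 0 < k -> sigma n = k * T -> mu <= T ->
  perm_eq res [seq d <- divisors n | d <= D0] ->
  (forall c, size c = k -> all (leq mu) c -> sumn c = sumn res -> realizable res c) ->
  (forall d, d %| n -> D0 < d -> k * (d + mu) <= \sum_(e <- divisors n | e <= d) e) ->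
  layered k n.
Proof.
move=> n0 k0 sigE muT permres resP dP.
pose l := rev [seq d <- divisors n | D0 < d].
have perml : perm_eq (l ++ res) (divisors n).
  apply: perm_trans (_ : perm_eq ([seq d <- divisors n | D0 < d] ++
     [seq d <- divisors n | ~~ (D0 < d)]) _); last by rewrite perm_filterC.
  apply: perm_cat; first by rewrite perm_rev.
  by rewrite (eq_filter (a2 := fun d => d <= D0)) // => d; rewrite -leqNgt.
(* For d > D0 the whole reserve counts among the divisors <= d, which turns the hypothesis on
   divisors into [room]. *)
have sum_res d : D0 < d -> \sum_(e <- res | e <= d) e = sumn res.
  move=> D0d; rewrite sumnE big_seq_cond [RHS]big_seq; apply: eq_bigl => e.
  rewrite andb_idr // (perm_mem permres) mem_filter => /andP[eD0 _]; lia.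
apply: (@realizable_layered k n T) => //.
  by move: (leq_sigma n0); rewrite sigE; case: T {muT sigE}; rewrite ?muln0 //; lia.
apply: (realizable_perm perml); apply: (greedy k0 resP).
- apply: room_sorted.
    rewrite rev_sorted; apply: sorted_filter; last exact: sorted_divisors_ltn.
    by move=> x y z; apply: ltn_trans.
  move=> d dl; have : d \in [seq d <- divisors n | D0 < d] by rewrite -mem_rev.
  rewrite mem_filter => /andP[D0d]; rewrite -dvdn_divisors // => dn.
  rewrite -(sum_res d D0d) -big_cat /= (perm_big _ perml); exact: dP.
- by rewrite size_nseq.
- by rewrite all_nseq muT orbT.
- by rewrite sumn_nseq mulnC -sigE sigma_sumn -sumn_cat (perm_sumn perml).
Qed.

(** * Subset sums and completion of the bins *)

Fixpoint orseq (s t : seq bool) : seq bool :=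
  match s, t with
  | a :: s', b :: t' => (a || b) :: orseq s' t'
  | [::], _ => t
  | _, [::] => s
  end.

Lemma nth_orseq s t i : nth false (orseq s t) i = nth false s i || nth false t i.
Proof.
elim: s t i => [|a s IH] [|b t] [|i] //=; rewrite ?nth_nil ?orbF //.
Qed.

(** Subset sums as a characteristic sequence: prefixing [b] entries [false] is the shift by b. *)
Fixpoint subset_sums (l : seq nat) : seq bool :=
  if l is b :: l' then
    let r := subset_sums l' in orseq r (nseq b false ++ r)
  else [:: true].

Lemma subset_sumsP l t : nth false (subset_sums l) t ->
  exists Y Z, perm_eq (Y ++ Z) l /\ sumn Y = t.
Proof.
elim: l t => [|b l IH] t /=.
  by case: t => [|t] /=; rewrite ?nth_nil // => _; exists [::], [::].
rewrite nth_orseq => /orP[/IH[Y [Z [pYZ sY]]]|].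
  exists Y, (b :: Z); split=> //.
  by rewrite -cat1s perm_catCA /= perm_cons.
rewrite nth_cat size_nseq nth_nseq; case: ltnP => // bt.
move=> /IH[Y [Z [pYZ sY]]]; exists (b :: Y), Z; split; first by rewrite /= perm_cons.
by rewrite /= sY; lia.
Qed.

(** The size test is essential: past the end of [r] the list taken would be short and the second
    test vacuous. *)
Definition window (a w : nat) (r : seq bool) :=
  (a + w < size r) && all id (take w.+1 (drop a r)).

Lemma windowP a w r t : window a w r -> a <= t <= a + w -> nth false r t.
Proof.
move=> /andP[sz /all_nthP-/(_ false) allr] /andP[at_ ta].
have tw : t - a < w.+1 by lia.
have := allr (t - a); rewrite size_take size_drop nth_take // nth_drop subnKC //.
by apply; case: ifP; lia.
Qed.

(* [s] is the sum of the blocks already opened and [lo] a lower bound for the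
   total capacity of the bins up to the current one; the elements of a block
   that its own bin does not take go to the next bin. *)
Fixpoint closing (mu w lo s : nat) (Bs : seq (seq nat)) : bool :=
  match Bs with
  | [::] => false
  | [:: B] => true
  | B :: Bs' => [&& s <= lo, window (lo - s) w (subset_sums B) &
                    closing mu w (lo + mu) (s + sumn B) Bs']
  end.

(** [P] is the total capacity of the bins already completed and [Z] what their blocks left over. The
    current bin takes [Z] and a subset of its own block; the rest of the block becomes the new [Z].
    The last bin fits because the totals agree. *)
Lemma closingP mu w lo s P Z Bs cs : closing mu w lo s Bs ->
  size cs = size Bs -> all (leq mu) cs -> P + sumn Z = s -> lo <= P + mu ->
  sumn Z + sumn (flatten Bs) = sumn cs ->
  P + sumn cs + mu <= lo + mu * size cs + w ->
  realizable (Z ++ flatten Bs) cs.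
Proof.
elim: Bs lo s P Z cs => // B Bs IH lo s P Z [//|c cs] clos /= [szc] /andP[muc mucs]
  PZ loP tot up.
case: Bs IH clos szc tot => [|B' Bs] IH clos szc tot.
  case: cs szc mucs tot up => //= _ _ tot up; exists [:: Z ++ B]; first by rewrite /= !cats0.
  by rewrite /= sumn_cat; congr [:: _]; move: tot; rewrite !cats0; lia.
case/and3P: clos => slo win clos.
have mu_cs : mu * size cs <= sumn cs.
  elim: (cs) mucs => [|x xs IHx] /=; [by rewrite muln0|case/andP=> mux /IHx; rewrite mulnS; lia].
(* The own block must supply c - sumn Z = P + c - s. This is at least lo - s as c >= mu, and at most
   lo - s + w as every later bin has capacity at least mu. *)
have [Y [Z' [permB sumY]]] : exists Y Z', perm_eq (Y ++ Z') B /\ sumn Y = P + c - s.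
  apply: subset_sumsP; apply: windowP win _; move: up; rewrite mulnS; lia.
have sumB : sumn B = sumn Y + sumn Z' by rewrite -(perm_sumn permB) sumn_cat.
have [||||||bins permb sumb] := IH _ _ (P + c) Z' cs clos.
- by [].
- by [].
- by rewrite sumB sumY; lia.
- by lia.
- move: tot; rewrite sumn_cat sumB sumY; lia.
- by move: up; rewrite mulnS; lia.
exists ((Z ++ Y) :: bins); last by rewrite /= sumb sumn_cat sumY; congr (_ :: _); lia.
rewrite /= -catA perm_cat2l.
apply: perm_trans (_ : perm_eq (Y ++ (Z' ++ flatten (B' :: Bs))) _).
  by rewrite perm_cat2l.
by rewrite catA perm_cat2r.
Qed.

(** * Lower bounds for sums of small divisors *)

Lemma uniq_leq_sum (s t : seq nat) (F : nat -> nat) : uniq s -> {subset s <= t} ->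
  \sum_(d <- s) F d <= \sum_(d <- t) F d.
Proof.
elim: s t => [|x s IH] t /=; first by rewrite big_nil.
move=> /andP[xs us] st; have xt : x \in t by apply: st; rewrite inE eqxx.
rewrite big_cons (perm_big _ (perm_to_rem xt)) big_cons leq_add2l.
apply: IH => // y ys; have := st y; rewrite inE ys orbT => /(_ isT).
by rewrite (perm_mem (perm_to_rem xt)) inE => /predU1P[yx|//]; rewrite -yx ys in xs.
Qed.

Definition below n x := \sum_(d <- divisors n | d < x) d.

(** All integers x are allowed, not only divisors, because multiplying n by q compares x with the
    ceiling of x / q, which need not be a divisor. *)
Definition dense k mu n lo hi :=
  forall x, lo < x <= hi -> k * (x + mu) <= below n x.

Lemma leq_below (ds : seq nat) n x : 0 < n -> uniq ds -> all (fun d => d %| n) ds ->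
  \sum_(d <- ds | d < x) d <= below n x.
Proof.
move=> n0 uds dsn; rewrite /below -big_filter -[leqRHS]big_filter.
apply: uniq_leq_sum; first exact: filter_uniq.
move=> d; rewrite !mem_filter => /andP[-> dds] /=.
by rewrite -dvdn_divisors // (allP dsn).
Qed.

(** Up to hi the divisors of n suffice. For x > hi put y = ceil(x / q), which lies in the old range
    since q lo <= hi. The divisors q d with d < y are below x and sum to at least q k (y + mu) >= k
    (x + mu). *)
Lemma dense_mul k mu n lo hi q : 0 < n -> 0 < q -> q * lo <= hi ->
  dense k mu n lo hi -> dense k mu (n * q) lo (hi * q).
Proof.
move=> n0 q0 qlo dn x /andP[lox xhi].
have nq0 : 0 < n * q by rewrite muln_gt0 n0.
have [xh|hx] := leqP x hi.
  apply: leq_trans (dn x _) _; first by rewrite lox.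
  apply: leq_below; rewrite ?divisors_uniq //; apply/allP => d.
  by rewrite -dvdn_divisors // => /dvdn_mulr->.
pose y := (x + q.-1) %/ q.
have yP d : (q * d < x) = (d < y).
  by rewrite /y; apply/idP/idP; nia.
have y_hi : lo < y <= hi by rewrite [y <= hi]leqNgt -!yP; lia.
apply: (@leq_trans (q * below n y)).
  apply: leq_trans (leq_mul (leqnn q) (dn y y_hi)).
  have : x <= q * y by rewrite leqNgt yP ltnn.
  by nia.
rewrite /below big_distrr /=.
apply: (@leq_trans (\sum_(d <- [seq q * d | d <- divisors n] | d < x) d)).
  by rewrite big_map; under [leqRHS]eq_bigl do rewrite yP.
apply: leq_below => //.
  by rewrite map_inj_uniq ?divisors_uniq // => a b /eqP; rewrite eqn_pmul2l // => /eqP.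
apply/allP => _ /mapP[d dd ->]; rewrite mulnC dvdn_mul //.
by rewrite dvdn_divisors.
Qed.

Lemma dense_trans k mu n a b c : dense k mu n a b -> dense k mu n b c ->
  dense k mu n a c.
Proof.
move=> ab bc x /andP[ax xc]; have [xb|bx] := leqP x b; first by apply: ab; rewrite ax.
by apply: bc; rewrite bx.
Qed.

(** A divisor d > n / E is n / e with e < E, and the sum of the divisors <= d is sigma(n) minus the
    n / f with f < e dividing n. *)
Lemma dense_top k mu n lo E d : 0 < n -> dense k mu n lo (n %/ E) -> 0 < E ->
  (forall e, 0 < e < E -> e %| n ->
     k * (n %/ e + mu) + \sum_(f <- iota 1 e.-1 | f %| n) n %/ f <= sigma n) ->
  d %| n -> lo < d -> k * (d + mu) <= \sum_(e <- divisors n | e <= d) e.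
Proof.
move=> n0 dn E0 top dvd lod.
have d0 : 0 < d by apply: dvdn_gt0 dvd.
have [dE|Ed] := leqP d (n %/ E).
  apply: leq_trans (dn d _) _; first by rewrite lod.
  by rewrite /below big_mkcond [leqRHS]big_mkcond leq_sum // => i _; case: ltngtP.
have [e nE] : exists e, n = d * e by case/dvdnP: dvd => e ->; exists e; rewrite mulnC.
have e0 : 0 < e by move: n0; rewrite nE muln_gt0 => /andP[].
have eE : e < E.
  by rewrite ltnNge; apply/negP => Ee; move: Ed; rewrite ltnNge leq_divRL ?nE ?leq_mul2l ?Ee ?orbT.
have dE : n %/ e = d by rewrite nE mulnK.
have := top e; rewrite e0 eE nE dvdn_mull // -nE dE => /(_ isT isT) topd.
rewrite -(leq_add2r (\sum_(f <- divisors n | ~~ (f <= d)) f)).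
apply: (@leq_trans (sigma n)); last by rewrite /sigma (bigID (fun f => f <= d)).
apply: leq_trans topd.
rewrite leq_add2l -big_filter -[leqRHS]big_filter.
have divdK f : f %| n -> n %/ (n %/ f) = f by move=> fn; rewrite divnA // mulKn.
set s := [seq _ <- divisors n | _].
have sn f : f \in s -> f %| n /\ d < f.
  by rewrite mem_filter -dvdn_divisors // -ltnNge => /andP[].
(* The involution f -> n / f sends the divisors above n / e to divisors below e. *)
apply: (@leq_trans (\sum_(f <- [seq n %/ f | f <- s]) n %/ f)).
  rewrite big_map big_seq [leqRHS]big_seq leq_sum // => f /sn[fn _].
  by rewrite divdK.
apply: uniq_leq_sum.
  rewrite map_inj_in_uniq ?filter_uniq ?divisors_uniq // => a b /sn[an _] /sn[bn _] ab.
  by rewrite -(divdK _ an) -(divdK _ bn) ab divdK.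
move=> _ /mapP[f /sn[fn df] ->]; rewrite mem_filter mem_iota.
have f0 : 0 < f by apply: dvdn_gt0 fn.
have fE : n = n %/ f * f by rewrite divnK.
have nf0 : 0 < n %/ f by rewrite divn_gt0 // dvdn_leq.
apply/andP; split; first by rewrite {2}fE dvdn_mulr.
by nia.
Qed.

(** * Verification by computation *)

Lemma to_nat_div n f : N.to_nat (n / f) = N.to_nat n %/ N.to_nat f.
Proof. 
have [->|f0] := eqVneq f 0%num; first by case: n.
have := N.mod_lt n f (elimN eqP f0); have := N.div_mod' n f.
move: (n / f)%num (n mod f)%num => q r nE rf.
have -> : N.to_nat n = N.to_nat q * N.to_nat f + N.to_nat r by lia.
by rewrite divnMDl ?divn_small ?addn0; lia.
Qed.
Lemma to_nat_mod n f : N.to_nat (n mod f) = N.to_nat n %% N.to_nat f.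
Proof.
have := N.div_mod' n f; have := divn_eq (N.to_nat n) (N.to_nat f).
rewrite -to_nat_div; lia.
Qed.

Lemma dvdn_Nmod n f : (n mod N.of_nat f =? 0)%num = (f %| N.to_nat n).
Proof. by have := to_nat_mod n (N.of_nat f); rewrite Nat2N.id /dvdn; lia. Qed.

Fixpoint scan (k mu lo acc : N) (ds : seq N) : bool :=
  if ds is d :: ds' then
    (if (lo <? d)%num then (k * (d + mu) <=? acc)%num else true) &&
    scan k mu lo (acc + d) ds'
  else true.

(** Between consecutive entries the sum of the smaller entries is constant while k (x + mu)
    increases, so testing at the entries is enough. *)
Lemma scanP k mu lo acc ds x : scan k mu lo acc ds ->
  N.to_nat lo < x <= last 0 (map N.to_nat ds) ->
  N.to_nat k * (x + N.to_nat mu) <=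
    N.to_nat acc + \sum_(d <- map N.to_nat ds | d < x) d.
Proof.
elim: ds acc => [|d ds IH] acc; first by rewrite /=; lia.
move=> /= /andP[test /IH{}IH] /andP[lox xlast]; rewrite big_cons.
case: (ltnP (N.to_nat d) x) => [dx|xd].
  case: ds IH xlast => [|d' ds] IH xlast; first by move: xlast => /=; lia.
  by have := IH; rewrite lox xlast => /(_ isT); lia.
move: test; case: ifP => [_ test|]; last by lia.
by apply: leq_trans (leq_addr _ _); nia.
Qed.

(** Distinct divisors, perhaps not all: this suffices for lower bounds on [below]. *)
Definition divisor_list (n : N) (ds : seq N) :=
  sorted N.ltb ds && all (fun d => (n mod d =? 0) && (0 <? d))%num ds.

Lemma divisor_listP n ds : divisor_list n ds ->
  uniq (map N.to_nat ds) /\ all (fun d => d %| N.to_nat n) (map N.to_nat ds).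
Proof.
case/andP=> sortedds divds; split; last first.
  rewrite all_map; apply: sub_all divds => d /= /andP[nd d0].
  apply/dvdnP; exists (N.to_nat (n / d)).
  by have := N.div_mod n d; lia.
apply: (sorted_uniq (leT := ltn)); [exact: ltn_trans|exact: ltnn|].
rewrite sorted_map; apply: sub_sorted sortedds => a b /=; lia.
Qed.

Lemma scan_dense k mu lo n ds : (0 <? n)%num -> divisor_list n ds -> scan k mu lo 0 ds ->
  dense (N.to_nat k) (N.to_nat mu) (N.to_nat n) (N.to_nat lo) (N.to_nat (last 0%num ds)).
Proof.
move=> n0 /divisor_listP[uds dds] test x /andP[lox xlast].
have := scanP (x := x) test; rewrite lox -[0](_ : N.to_nat 0 = 0) // last_map xlast => /(_ isT).
move=> h; apply: leq_trans h _; rewrite add0n; apply: leq_below => //; lia.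
Qed.

Definition fact_val (f : seq (nat * nat)) : N :=
  foldr (fun x n => N.of_nat x.1 ^ N.of_nat x.2 * n)%num 1%num f.

Definition fact_sigma (f : seq (nat * nat)) : N :=
  foldr (fun x s => iter x.2 (fun t => t * N.of_nat x.1 + 1) 1 * s)%num 1%num f.

Definition factored (f : seq (nat * nat)) := all prime (unzip1 f) && uniq (unzip1 f).

Lemma factoredP f : factored f ->
  [/\ 0 < N.to_nat (fact_val f),
      sigma (N.to_nat (fact_val f)) = N.to_nat (fact_sigma f) &
      forall q, prime q -> q %| N.to_nat (fact_val f) -> q \in unzip1 f].
Proof.
elim: f => [_|[p e] f IH] /=.
  by split; rewrite ?sigma1 // => q q_pr; rewrite dvdn1 => /eqP q1; rewrite q1 in q_pr.
case/andP=> /= /andP[p_pr f_pr] /andP[pf uf].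
have [|v0 vs vq] := IH; first by rewrite /factored f_pr.
have p_gt0 := prime_gt0 p_pr.
have -> : N.to_nat (N.of_nat p ^ N.of_nat e * fact_val f) =
  p ^ e * N.to_nat (fact_val f) by lia.
split.
- by rewrite muln_gt0 expn_gt0 p_gt0.
- rewrite sigma_primeX //; last by apply: contra pf; apply: vq.
  rewrite vs; set t := iter _ _ _; suff -> : geom p e = N.to_nat t by lia.
  by rewrite /t; elim: e {t} => [|e IHe]; rewrite ?geom0 // geomS iterS IHe; lia.
- move=> q q_pr; rewrite Euclid_dvdM // Euclid_dvdX // inE => /orP[|].
    by case/andP; rewrite dvdn_prime2 // => ->.
  by move=> /(vq q q_pr)->; rewrite orbT.
Qed.

Definition bins_check (k : nat) (f : seq (nat * nat)) (bins : seq (seq N)) : bool :=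
  let T := (fact_sigma f / N.of_nat k)%num in
  [&& factored f, size bins == k, T * N.of_nat k =? fact_sigma f,
      all (fun b => foldr N.add 0 b =? T) bins &
      divisor_list (fact_val f) (sort N.leb (flatten bins))]%num.

Lemma sumn_to_nat (b : seq N) : sumn (map N.to_nat b) = N.to_nat (foldr N.add 0%num b).
Proof. by elim: b => //= x b ->; lia. Qed.

(** The bins hold distinct divisors whose total is already sigma(n), so no divisor can be
    missing. *)
Lemma bins_layered k f bins : 0 < k -> bins_check k f bins -> layered k (N.to_nat (fact_val f)).
Proof.
move=> k0 /and5P[/factoredP[n0 sigE _] /eqP sizeb sumT allT] /divisor_listP[uds dds].
set T := (fact_sigma f / N.of_nat k)%num in sumT allT.
pose l := map N.to_nat (flatten bins).
have perml : perm_eq (map N.to_nat (sort N.leb (flatten bins))) l.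
  by apply: perm_map; apply/permPl/perm_sort.
have map_sums : map sumn (map (map N.to_nat) bins) = nseq k (N.to_nat T).
  rewrite -sizeb; elim: bins allT {sizeb uds dds l perml} => //= b bins IH.
  by case/andP=> /eqP bT /IH->; rewrite sumn_to_nat; congr (_ :: _); lia.
have sum_l : sumn l = sigma (N.to_nat (fact_val f)).
  rewrite /l map_flatten sumn_flatten map_sums sumn_nseq sigE; lia.
have ul : uniq l by rewrite -(perm_uniq perml).
have dl d : d \in l -> d %| N.to_nat (fact_val f).
  by rewrite -(perm_mem perml) => /(allP dds).
apply: (realizable_layered (T := N.to_nat T)) => //.
  by have := leq_sigma n0; rewrite sigE; lia.
exists (map (map N.to_nat) bins) => //; rewrite -map_flatten -/l.
apply: uniq_perm; rewrite ?divisors_uniq // => d.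
rewrite -dvdn_divisors //; apply/idP/idP; first exact: dl.
move=> dn; apply: contraT => dNl.
have : sumn l + d <= sigma (N.to_nat (fact_val f)).
  rewrite sumnE addnC -(big_cons _ _ d l xpredT id) /sigma.
  apply: uniq_leq_sum; first by rewrite /= dNl.
  by move=> e; rewrite inE -dvdn_divisors // => /predU1P[->|/dl].
have : 0 < d by apply: dvdn_gt0 dn.
by rewrite sum_l; lia.
Qed.

Lemma dense_prod k mu n lo hi (qs : seq nat) : 0 < n ->
  all (fun q => 0 < q) qs -> all (fun q => q * lo <= hi) qs ->
  dense k mu n lo hi -> dense k mu (n * \prod_(q <- qs) q) lo (hi * \prod_(q <- qs) q).
Proof.
elim: qs n hi => [|q qs IH] n hi n0 /=; first by rewrite big_nil !muln1.
case/andP=> q0 qs0 /andP[qlo qslo] dn; rewrite big_cons !mulnA.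
apply: IH => //; first by rewrite muln_gt0 n0.
  apply: sub_all qslo => r rlo; apply: leq_trans rlo _; exact: leq_pmulr.
exact: dense_mul.
Qed.

(** The output is certified afterwards by [divisor_list] inside [layered_check]. *)
Definition divisors_upto (f : seq (nat * nat)) (hi : N) : seq N :=
  sort N.leb [seq d <- foldr (fun x ds =>
    [seq N.of_nat x.1 ^ N.of_nat i * d | i <- iota 0 x.2.+1, d <- ds])%num [:: 1%num] f
    | (d <=? hi)%num].

Definition top_check (k mu n s : N) (E : nat) : bool :=
  all (fun e =>
    if (n mod N.of_nat e =? 0)%num then
      (k * (n / N.of_nat e + mu) +
       foldr (fun f t => if n mod N.of_nat f =? 0 then n / N.of_nat f + t else t) 0
         (iota 1 e.-1) <=? s)%num
    else true) (iota 1 E.-1).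

Lemma top_checkP k mu n s E : top_check k mu n s E ->
  forall e, 0 < e < E -> e %| N.to_nat n ->
  N.to_nat k * (N.to_nat n %/ e + N.to_nat mu) +
    \sum_(f <- iota 1 e.-1 | f %| N.to_nat n) N.to_nat n %/ f <= N.to_nat s.
Proof.
move=> /allP test e /andP[e0 eE] en; have := test e.
rewrite mem_iota => /(_ _)/wrap[]; first by lia.
rewrite dvdn_Nmod en.
have -> : foldr (fun f t => if (n mod N.of_nat f =? 0)%num then (n / N.of_nat f + t)%num else t)
    0%num (iota 1 e.-1) = N.of_nat (\sum_(f <- iota 1 e.-1 | f %| N.to_nat n) N.to_nat n %/ f).
  elim: (iota _ _) => [|f l IH] /=; first by rewrite big_nil.
  rewrite IH big_cons dvdn_Nmod; case: ifP => // _.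
  by have := to_nat_div n (N.of_nat f); rewrite Nat2N.id; lia.
have := to_nat_div n (N.of_nat e); rewrite Nat2N.id => <-; lia.
Qed.

(* The inequality S(d) >= k (d + mu) is checked on the small divisors up to [lo],
   then on the divisors of the factor m of n up to m / E, which extends it to
   the divisors of n = m * prod qs up to n / E, and finally on each n / e with
   e < E. *)
Definition layered_check (k mu w D0 lo E : nat) (f core : seq (nat * nat)) (qs : seq nat)
    (Bs : seq (seq nat)) : bool :=
  let n := fact_val f in
  let s := fact_sigma f in
  let m := fact_val core in
  let K := N.of_nat k in
  let MU := N.of_nat mu in
  let LO := N.of_nat lo in
  let hi := (m / N.of_nat E)%num in
  let divs b := [seq d <- iota 1 b | (n mod N.of_nat d =? 0)%num] in
  let ds1 := map N.of_nat (divs lo) in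
  let ds2 := divisors_upto core hi in
  [&& [&& factored f, (0 < k), (0 < E), (s mod K =? 0)%num & (MU * K <=? s)%num],
      [&& size Bs == k, sort leq (flatten Bs) == divs D0,
          sumn (flatten Bs) <= mu * k + w & closing mu w mu 0 Bs],
      [&& divisor_list n ds1, last 0%num ds1 == LO & scan K MU (N.of_nat D0) 0 ds1],
      [&& divisor_list m ds2, last 0%num ds2 == hi & scan K MU LO 0 ds2],
      [&& (0 <? m)%num, all (fun q => 0 < q) qs,
          all (fun q => (N.of_nat q * LO <=? hi)%num) qs,
          (hi * N.of_nat E =? m)%num &
          (m * foldr (fun q t => N.of_nat q * t) 1 qs =? n)%num] &
      top_check K MU n s E].

Lemma layered_checkP k mu w D0 lo E f core qs Bs :
  layered_check k mu w D0 lo E f core qs Bs -> layered k (N.to_nat (fact_val f)).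
Proof.
case/and5P=> /and5P[/factoredP[n0 sigE _] k0 E0 kdvd muk].
set n := fact_val f in n0 sigE *; set m := fact_val core.
set hi := (m / N.of_nat E)%num.
case/and4P=> /eqP sizeB /eqP sortB sumB clos /and3P[ds1 /eqP last1 scan1]
  /and3P[ds2 /eqP last2 scan2] /andP[/and5P[m0 qs0 qslo hiE mn] top].
have KE : N.to_nat (N.of_nat k) = k by lia.
have ME : N.to_nat (N.of_nat mu) = mu by lia.
have LE : N.to_nat (N.of_nat lo) = lo by lia.
have DE : N.to_nat (N.of_nat D0) = D0 by lia.
have dense1 : dense k mu (N.to_nat n) D0 lo.
  have := scan_dense _ ds1 scan1; rewrite last1 KE ME LE DE; apply; lia.
have dense2 : dense k mu (N.to_nat m) lo (N.to_nat hi).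
  by have := scan_dense m0 ds2 scan2; rewrite last2 KE ME LE.
have prodE : N.to_nat (foldr (fun q t => N.of_nat q * t)%num 1%num qs) = \prod_(q <- qs) q.
  elim: (qs) => [|q l IH]; rewrite ?big_nil // big_cons -IH /=; lia.
have nE : N.to_nat n = N.to_nat m * \prod_(q <- qs) q by rewrite -prodE; lia.
(* Since m = hi E exactly, n / E is hi times the product of [qs], the range given by
   [dense_prod]. *)
have dense3 : dense k mu (N.to_nat n) lo (N.to_nat n %/ E).
  have -> : N.to_nat n %/ E = N.to_nat hi * \prod_(q <- qs) q.
    have -> : N.to_nat n = N.to_nat hi * \prod_(q <- qs) q * E.
      by rewrite nE mulnAC; congr (_ * _); lia.
    by rewrite mulnK.
  rewrite nE; apply: dense_prod => //; first by lia.
  by apply: sub_all qslo => q; lia.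
have kT : sigma (N.to_nat n) = k * N.to_nat (fact_sigma f / N.of_nat k).
  rewrite sigE; have := N.div_mod (fact_sigma f) (N.of_nat k); lia.
apply: (@layered_greedy k mu (N.to_nat n) _ D0 (flatten Bs) n0 k0 kT).
- move: kT; rewrite sigE => kT; rewrite -(leq_pmul2l k0) -kT; lia.
- rewrite -(perm_sort leq) sortB; apply: uniq_perm.
  + by rewrite filter_uniq ?iota_uniq.
  + by rewrite filter_uniq ?divisors_uniq.
  move=> d; rewrite !mem_filter mem_iota -dvdn_divisors //.
  rewrite dvdn_Nmod -/n; case: (boolP (d %| N.to_nat n)) => [dn|_]; last by rewrite andbF.
  by have : 0 < d; [apply: dvdn_gt0 dn|lia].
(* At the start no bin is complete: P = 0, [Z] is empty, and lo = mu bounds the first capacity. *)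
- move=> c sizec cmu sumc.
  apply: (closingP (P := 0) (Z := [::]) clos) => //; first by rewrite sizec sizeB.
  by rewrite add0n sumc sizec; lia.
- move=> d dn Dd; apply: (dense_top n0 (dense_trans dense1 dense3)) Dd => //.
  have := top_checkP top; rewrite KE ME => topP e eE en.
  by rewrite sigE; apply: topP.
Qed.

Lemma smallest_eq_of_search k (g : N) B Q j :
  search (2 ^ 30) (N.of_nat k) g B Q j -> layered k (N.to_nat g) ->
  exists g k' : nat,
    [/\ smallest (good_abundant k) g, smallest (layered k) k' & g = k'].
Proof.
move=> test lay; apply: (smallest_good_layered lay) => m lt.
by have := search_sound test lt; rewrite Nat2N.id.
Qed.

(** * The eight cases *)

Lemma layered1 : layered 1 (N.to_nat 1).
Proof. by apply: (@bins_layered 1 [::] [:: [:: 1%num]]); vm_compute. Qed.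

Lemma layered2 : layered 2 (N.to_nat 6).
Proof.
have -> : 6%num = fact_val [:: (2, 1); (3, 1)] by vm_compute.
by apply: (@bins_layered 2 _ ([:: [:: 6]; [:: 3; 2; 1]]%num)); vm_compute.
Qed.

Lemma layered3 : layered 3 (N.to_nat 120).
Proof.
have -> : 120%num = fact_val [:: (2, 3); (3, 1); (5, 1)] by vm_compute.
by apply: (@bins_layered 3 _ ([:: [:: 120]; [:: 60; 40; 20]; [:: 30; 24;
  15; 12; 10; 8; 6; 5; 4; 3; 2; 1]]%num)); vm_compute.
Qed.

Lemma layered4 : layered 4 (N.to_nat 27720).
Proof.
have -> : 27720%num = fact_val [:: (2, 3); (3, 2); (5, 1); (7, 1); (11, 1)]
  by vm_compute.
by apply: (@bins_layered 4 _ ([:: [:: 27720; 90; 72; 60; 44; 35; 24; 18;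
  10; 7]; [:: 13860; 3465; 2310; 1540; 1386; 990; 792; 660; 616; 420; 360;
  308; 264; 220; 198; 140; 120; 110; 77; 70; 56; 40; 28; 20; 15; 8; 6; 1];
  [:: 9240; 4620; 3080; 2520; 1848; 1260; 924; 840; 693; 504; 462; 396; 315;
  280; 210; 180; 154; 132; 99; 88; 63; 55; 36; 30; 21; 14; 9; 5; 2]; [::
  6930; 5544; 3960; 2772; 1980; 1320; 1155; 770; 630; 495; 440; 385; 330;
  252; 231; 168; 165; 126; 105; 84; 66; 45; 42; 33; 22; 12; 11; 4; 3]]%num));
  vm_compute.
Qed.

(* Let W = R - k mu, where R is the sum of the divisors <= D0. The first block
   has sum about mu + W + L and each of the next ones about mu, for a small L, so
   that the subset sums required of a block avoid its extreme values, where
   there are gaps. *)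
Definition blocks5 : seq (seq nat) :=
  [:: [:: 192; 189; 187; 182; 180; 176; 160; 143; 130; 112; 102; 88; 77; 65;
  63; 45; 42; 30; 26; 16; 14; 5; 4]; [:: 170; 144; 136; 120; 108; 90; 80; 70;
  56; 51; 40; 32; 24; 18; 13; 6; 3]; [:: 168; 153; 132; 119; 104; 96; 78; 68;
  55; 52; 39; 33; 22; 20; 12; 7; 2]; [:: 165; 154; 135; 117; 105; 91; 84; 66;
  60; 48; 36; 34; 27; 17; 11; 8; 1]; [:: 156; 140; 126; 110; 99; 85; 72; 64;
  54; 44; 35; 28; 21; 15; 10; 9]].

Lemma layered5 : layered 5 (N.to_nat 147026880).
Proof.
have -> : 147026880%num = fact_val [:: (2, 6); (3, 3); (5, 1); (7, 1); (11,
  1); (13, 1); (17, 1)] by vm_compute.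
(* The numbers are k, mu, w, D0, lo and E, with w = R - k mu. The core collects the powers of 2, 3,
   5 and 7. *)
by apply: (@layered_checkP 5 1160 976 192 448 3 _ [:: (2, 6); (3, 3); (5,
  1); (7, 1)] [:: 11; 13; 17] blocks5); vm_compute.
Qed.

Definition blocks6 : seq (seq nat) :=
  [:: [:: 170; 168; 165; 161; 160; 156; 154; 145; 135; 120; 117; 108; 91; 88;
  70; 68; 56; 49; 40; 33; 27; 19; 15; 8; 3]; [:: 153; 136; 132; 112; 104; 95;
  84; 76; 63; 55; 50; 39; 34; 26; 20; 14; 9; 2]; [:: 152; 138; 130; 114; 100;
  98; 80; 77; 65; 58; 46; 44; 30; 28; 18; 16; 7; 4]; [:: 150; 140; 128; 115;
  102; 96; 85; 75; 64; 54; 51; 38; 35; 25; 21; 13; 10; 1]; [:: 147; 143; 126;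
  116; 105; 92; 87; 72; 66; 57; 48; 42; 32; 24; 22; 12; 11]; [:: 144; 133;
  119; 110; 99; 90; 78; 69; 60; 52; 45; 36; 29; 23; 17; 6; 5]].

Lemma layered6 : layered 6 (N.to_nat 130429015516800).
Proof.
have -> : 130429015516800%num = fact_val [:: (2, 7); (3, 3); (5, 2); (7,
  2); (11, 1); (13, 1); (17, 1); (19, 1); (23, 1); (29, 1)] by vm_compute.
by apply: (@layered_checkP 6 1204 1031 170 378 3 _ [:: (2, 7); (3, 3); (5,
  2); (7, 2)] [:: 11; 13; 17; 19; 23; 29] blocks6); vm_compute.
Qed.

Definition blocks7 : seq (seq nat) :=
  [:: [:: 176; 175; 174; 172; 171; 170; 168; 165; 156; 147; 136; 126; 123;
  105; 100; 88; 85; 69; 66; 52; 50; 38; 36; 24; 22; 10; 9]; [:: 164; 148;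
  144; 128; 120; 106; 102; 87; 84; 70; 65; 53; 49; 39; 35; 25; 21; 11; 8];
  [:: 162; 150; 143; 129; 119; 108; 99; 90; 81; 74; 62; 56; 45; 43; 31; 29;
  17; 15; 3; 2]; [:: 161; 152; 141; 130; 117; 110; 98; 91; 80; 75; 60; 57;
  47; 41; 33; 27; 19; 13; 5]; [:: 160; 153; 140; 132; 115; 112; 95; 93; 78;
  76; 63; 55; 46; 42; 32; 28; 18; 14; 4; 1]; [:: 159; 154; 138; 133; 116;
  111; 96; 92; 82; 72; 64; 54; 48; 40; 34; 26; 20; 12; 7]; [:: 155; 145; 135;
  124; 114; 104; 94; 86; 77; 68; 58; 51; 44; 37; 30; 23; 16; 6]].

Lemma layered7 : layered 7 (N.to_nat 1970992304700453905270400).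
Proof.
have -> : 1970992304700453905270400%num = fact_val [:: (2, 7); (3, 4); (5,
  2); (7, 2); (11, 1); (13, 1); (17, 1); (19, 1); (23, 1); (29, 1); (31, 1);
  (37, 1); (41, 1); (43, 1); (47, 1); (53, 1)] by vm_compute.
by apply: (@layered_checkP 7 1458 1263 176 448 3 _ [:: (2, 7); (3, 4); (5,
  2); (7, 2)] [:: 11; 13; 17; 19; 23; 29; 31; 37; 41; 43; 47; 53] blocks7);
  vm_compute.
Qed.

Definition blocks8 : seq (seq nat) :=
  [:: [:: 209; 208; 207; 205; 204; 203; 201; 200; 198; 196; 185; 175; 156;
  154; 136; 134; 119; 115; 99; 93; 82; 77; 66; 61; 50; 45; 34; 29; 18; 13;
  2]; [:: 195; 177; 166; 164; 150; 141; 128; 124; 108; 106; 90; 85; 74; 69;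
  58; 53; 42; 37; 26; 21; 10; 5]; [:: 192; 178; 174; 158; 148; 142; 133; 118;
  117; 96; 95; 81; 78; 65; 62; 49; 46; 33; 30; 17; 14; 1]; [:: 190; 180; 172;
  160; 147; 143; 132; 120; 114; 100; 92; 83; 76; 67; 60; 51; 44; 35; 28; 19;
  12; 3]; [:: 189; 182; 171; 159; 153; 138; 130; 122; 112; 102; 91; 84; 75;
  68; 59; 52; 43; 36; 27; 20; 11; 4]; [:: 188; 183; 170; 161; 146; 144; 129;
  123; 111; 104; 89; 86; 73; 70; 57; 54; 41; 38; 25; 22; 9; 6]; [:: 187; 184;
  168; 162; 152; 140; 126; 125; 110; 105; 88; 87; 72; 71; 56; 55; 40; 39; 24;
  23; 8; 7]; [:: 186; 176; 165; 155; 145; 135; 121; 116; 98; 94; 80; 79; 64;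
  63; 48; 47; 32; 31; 16; 15]].

Lemma layered8 : layered 8 (N.to_nat 1897544233056092162003806758651798777216000).
Proof.
have -> : 1897544233056092162003806758651798777216000%num = fact_val [::
  (2, 10); (3, 5); (5, 3); (7, 2); (11, 2); (13, 1); (17, 1); (19, 1); (23,
  1); (29, 1); (31, 1); (37, 1); (41, 1); (43, 1); (47, 1); (53, 1); (59, 1);
  (61, 1); (67, 1); (71, 1); (73, 1); (79, 1); (83, 1); (89, 1)] by
  vm_compute.
(* Here the core has only the primes 2, 3 and 5; the squares of 7 and 11 appear as repeated
   factors. *)
by apply: (@layered_checkP 8 2028 1686 209 1125 8 _ [:: (2, 10); (3, 5);
  (5, 3)] [:: 7; 7; 11; 11; 13; 17; 19; 23; 29; 31; 37; 41; 43; 47; 53; 59;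
  61; 67; 71; 73; 79; 83; 89] blocks8); vm_compute.
Qed.

Theorem proposition4p12 (i : nat) (hi : 1 <= i <= 8) :
  exists g k : nat,
    [/\ smallest (good_abundant i) g, smallest (layered i) k & g = k].
Proof.
case: i hi => [//|i] hi; do 8?[case: i hi => [_|i hi]]; last by lia.
(* After k and g come B, Q and j. The exponent eps = B / 2^j decreases from 1/4 to 5/2048, and Q is
   a prime beyond the prime factors of g. *)
- by apply: (@smallest_eq_of_search 1 1 1 5 2 _ layered1); vm_compute.
- by apply: (@smallest_eq_of_search 2 6 1 5 2 _ layered2); vm_compute.
- by apply: (@smallest_eq_of_search 3 120 1 11 4 _ layered3); vm_compute.
- by apply: (@smallest_eq_of_search 4 27720 1 13 5 _ layered4); vm_compute.
- by apply: (@smallest_eq_of_search 5 147026880 1 23 6 _ layered5); vm_compute.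
- by apply: (@smallest_eq_of_search 6 130429015516800 1 37 7 _ layered6); vm_compute.
- by apply: (@smallest_eq_of_search 7 1970992304700453905270400 1 67 8 _ layered7); vm_compute.
- by apply: (@smallest_eq_of_search 8 1897544233056092162003806758651798777216000
               5 97 11 _ layered8); vm_compute.
Qed.
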